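(* Let $(C,V,i,p,K)$ be a homotopy retract where $C$ is a cocommutative differential graded coalgebra, and consider the $C_\infty$-coalgebra structure transferred to $V$, with corresponding differential $d$ on the complete tensor algebra $\widehat T(s^{-1}V)$. Then $d$ restricts to Lie polynomials: $d(s^{-1}v)\in\widehat{\mathbb L}(s^{-1}V)$ for every generator $s^{-1}v\in s^{-1}V$.
   Context: The ground field has characteristic $0$; graded objects are $\mathbb Z$-graded, differentials have degree $-1$, tensor products of maps follow the Koszul sign rule. A homotopy retract $(C,V,i,p,K)$ consists of chain maps $i\colon V\to C$, $p\colon C\to V$ with $pi=\mathrm{id}_V$ and a map $K\colon C\to C$ of degree $1$ with $ip-\mathrm{id}_C=\delta K+K\delta$, where $(C,\delta,\Delta)$ is the coalgebra. $\widehat T(W)=\prod_{n\ge0}W^{\otimes n}$, and $\widehat{\mathbb L}(W)=\prod_{n\ge1}\mathbb L^n(W)\subset\widehat T(W)$ is the complete free graded Lie algebra, where $\mathbb L(W)\subset T(W)$ is generated by graded commutators on $W$. Desuspension: $(s^{-1}V)_q=V_{q+1}$. An $A_\infty$-coalgebra structure $\{\Delta_k\}_{k\ge1}$ on $V$ corresponds to a differential $d=\sum_{k\ge1}d_k$ on $\widehat T(s^{-1}V)$ with $d_k(s^{-1}V)\subset (s^{-1}V)^{\otimes k}$, where $d_k$ and $\Delta_k$ determine each other by (de)suspension. The structure transferred from $C$ (by the homotopy transfer theorem) is, in desuspended form, as follows. On $s^{-1}C$ put $b(s^{-1}c)=-\sum(-1)^{|c'|}s^{-1}c'\otimes s^{-1}c''$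 where $\Delta c=\sum c'\otimes c''$, $H=-s^{-1}Ks$, $\hat\imath=s^{-1}is$, $\hat p=s^{-1}ps$. For a planar rooted binary tree $T$ with $k\ge2$ leaves, $d_T\colon s^{-1}V\to(s^{-1}V)^{\otimes k}$ is the composition, moving up from the root to the leaves, obtained by labelling the root with $\hat\imath$, each internal vertex with $b$, each internal edge with $H$, and each leaf with $\hat p$. Then $d_1=-s^{-1}d_Vs$ and, for $k\ge2$, $d_k=\sum_Td_T$, summed over all isomorphism classes of planar rooted binary trees with $k$ leaves. *)

(* Defs.v *)
From HB Require Import structures.
From mathcomp Require Import all_boot all_order all_algebra.
From mathcomp Require Import boolp classical_sets functions cardinality fsbigop.
From mathcomp Require Import zify.
Set Implicit Arguments.
Unset Strict Implicit.
Unset Printing Implicit Defensive.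
Import Order.TTheory GRing.Theory Num.Theory.
Local Open Scope ring_scope.
Local Open Scope quotient_scope.

Section LinearProp.
Variables (F : fieldType) (U V : lmodType F) (f : U -> V) (lf : linear f).

Lemma lin0 : f 0 = 0.
Proof. by have := lf (-1) 0 0; rewrite scaler0 addr0 scaleN1r addNr. Qed.

Lemma linD x y : f (x + y) = f x + f y.
Proof. by have := lf 1 x y; rewrite !scale1r. Qed.

Lemma linZ a x : f (a *: x) = a *: f x.
Proof. by have := lf a x 0; rewrite lin0 !addr0. Qed.

End LinearProp.

Definition bilinear_map (F : fieldType) (U V M : lmodType F)
    (f : U -> V -> M) : Prop :=
  (forall v, linear (f^~ v)) /\ (forall u, linear (f u)).

Section Tensor.
Variables (F : fieldType) (U V : lmodType F).

(* A formal sum of simple tensors is a sequence of pairs; [tens_eq] is the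
   additive congruence generated by bilinearity. *)
Inductive tens_eq : seq (U * V) -> seq (U * V) -> Prop :=
| Tens_refl s : tens_eq s s
| Tens_sym s t : tens_eq s t -> tens_eq t s
| Tens_trans s t r : tens_eq s t -> tens_eq t r -> tens_eq s r
| Tens_cat s t s' t' : tens_eq s t -> tens_eq s' t' -> tens_eq (s ++ s') (t ++ t')
| Tens_comm s t : tens_eq (s ++ t) (t ++ s)
| Tens_zero v : tens_eq [:: (0, v)] [::]
| Tens_addl u u' v : tens_eq [:: (u + u', v)] [:: (u, v); (u', v)]
| Tens_addr u v v' : tens_eq [:: (u, v + v')] [:: (u, v); (u, v')]
| Tens_scale a u v : tens_eq [:: (a *: u, v)] [:: (u, a *: v)].

Definition tens_eqb (s t : seq (U * V)) : bool := `[< tens_eq s t >].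

Lemma tens_eqb_equiv : equiv_class_of tens_eqb.
Proof.
split.
- by move=> s; apply/asboolP; exact: Tens_refl.
- by move=> s t; apply/asboolP/asboolP => h; exact: Tens_sym.
- move=> s t r /asboolP h /asboolP h'; apply/asboolP; exact: Tens_trans h h'.
Qed.

Canonical tens_equiv := EquivRelPack tens_eqb_equiv.

Definition tens : Type := {eq_quot tens_equiv}.
HB.instance Definition _ := Choice.on tens.
HB.instance Definition _ := EqQuotient.on tens.

Lemma tens_eqP s t : tens_eq s t -> \pi_tens s = \pi_tens t.
Proof. by move=> h; apply/eqmodP/asboolP. Qed.

Lemma tens_eqE s t : \pi_tens s = \pi_tens t -> tens_eq s t.
Proof. by move/eqmodP/asboolP. Qed.

Definition tens_add (x y : tens) : tens := \pi_tens (repr x ++ repr y).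
Definition tens_map1 (f : U -> U) (s : seq (U * V)) := [seq (f p.1, p.2) | p <- s].
Definition tens_scale (a : F) (x : tens) : tens :=
  \pi_tens (tens_map1 ( *:%R a) (repr x)).
Definition tens_zero : tens := \pi_tens [::].
Definition tens_opp (x : tens) : tens := tens_scale (-1) x.

Lemma tens_addE s t : tens_add (\pi_tens s) (\pi_tens t) = \pi_tens (s ++ t).
Proof. by apply: tens_eqP; apply: Tens_cat; apply: tens_eqE; rewrite reprK. Qed.

Lemma tens_scale_eq a s t :
  tens_eq s t -> tens_eq (tens_map1 ( *:%R a) s) (tens_map1 ( *:%R a) t).
Proof.
elim=> {s t} /=.
- by move=> s; exact: Tens_refl.
- by move=> s t _ h; exact: Tens_sym.
- by move=> s t r _ h _ h'; exact: Tens_trans h h'.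
- by move=> s t s' t' _ h _ h'; rewrite /tens_map1 !map_cat; exact: Tens_cat.
- by move=> s t; rewrite /tens_map1 !map_cat; exact: Tens_comm.
- by move=> v; rewrite scaler0; exact: Tens_zero.
- by move=> u u' v; rewrite scalerDr; exact: Tens_addl.
- by move=> u v v'; exact: Tens_addr.
- by move=> b u v; rewrite scalerA mulrC -scalerA; exact: Tens_scale.
Qed.

Lemma tens_scaleE a s :
  tens_scale a (\pi_tens s) = \pi_tens (tens_map1 ( *:%R a) s).
Proof.
rewrite /tens_scale; apply: tens_eqP; apply: tens_scale_eq.
by apply: tens_eqE; rewrite reprK.
Qed.

Lemma tens_addA : associative tens_add.
Proof.
move=> x y z; rewrite -[x]reprK -[y]reprK -[z]reprK.
by rewrite (tens_addE (repr y)) (tens_addE (repr x) (repr y)) !tens_addE catA.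
Qed.

Lemma tens_addC : commutative tens_add.
Proof.
move=> x y; rewrite -[x]reprK -[y]reprK !tens_addE.
by apply: tens_eqP; exact: Tens_comm.
Qed.

Lemma tens_add0 : left_id tens_zero tens_add.
Proof. by move=> x; rewrite -[x]reprK tens_addE. Qed.

Lemma tens_scaleDl (a b : F) x :
  tens_scale (a + b) x = tens_add (tens_scale a x) (tens_scale b x).
Proof.
rewrite -[x]reprK !tens_scaleE tens_addE; apply: tens_eqP.
elim: (repr x) => [|[u v] s IH] /=; first exact: Tens_refl.
set X := (a *: u, v); set Y := (b *: u, v).
set A := tens_map1 ( *:%R a) s; set B := tens_map1 ( *:%R b) s.
apply: (@Tens_trans _ ([:: X; Y] ++ (A ++ B))).
  by rewrite -[Z in tens_eq Z _]cat1s scalerDl; apply: Tens_cat IH; exact: Tens_addl.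
have -> : [:: X; Y] ++ (A ++ B) = [:: X] ++ (([:: Y] ++ A) ++ B) by [].
have -> : X :: A ++ Y :: B = [:: X] ++ ((A ++ [:: Y]) ++ B) by rewrite -catA.
apply: Tens_cat; first exact: Tens_refl.
by apply: Tens_cat; [exact: Tens_comm | exact: Tens_refl].
Qed.

Lemma tens_scale0 x : tens_scale 0 x = tens_zero.
Proof.
rewrite -[x]reprK tens_scaleE; apply: tens_eqP.
elim: (repr x) => [|[u v] s IH] /=; first exact: Tens_refl.
rewrite scale0r -cat1s -[X in tens_eq _ X]cats0.
by apply: Tens_cat IH; exact: Tens_zero.
Qed.

Lemma tens_scale1 x : tens_scale 1 x = x.
Proof.
rewrite -[x]reprK tens_scaleE; congr (\pi_tens _).
by elim: (repr x) => //= -[u v] s /= ->; rewrite scale1r.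
Qed.

Lemma tens_addN : left_inverse tens_zero tens_opp tens_add.
Proof.
by move=> x; rewrite -{2}[x]tens_scale1 -tens_scaleDl addNr tens_scale0.
Qed.

HB.instance Definition _ :=
  GRing.isZmodule.Build tens tens_addA tens_addC tens_add0 tens_addN.

Lemma tens_scaleA (a b : F) (x : tens) :
  tens_scale a (tens_scale b x) = tens_scale (a * b) x.
Proof.
rewrite -[x]reprK (tens_scaleE b) !tens_scaleE /tens_map1 -map_comp.
by congr (\pi_tens _); apply: eq_map => -[u v] /=; rewrite scalerA.
Qed.

Lemma tens_scaleDr : right_distributive tens_scale +%R.
Proof.
move=> a x y; rewrite -[x]reprK -[y]reprK /GRing.add /=.
by rewrite (tens_addE (repr x)) !tens_scaleE tens_addE /tens_map1 map_cat.
Qed.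

Lemma tens_scaleDl' (x : tens) : {morph tens_scale^~ x : a b / a + b}.
Proof. by move=> a b; exact: tens_scaleDl. Qed.

HB.instance Definition _ := GRing.Zmodule_isLmodule.Build F tens
  tens_scaleA tens_scale1 tens_scaleDr tens_scaleDl'.

Definition tpure (u : U) (v : V) : tens := \pi_tens [:: (u, v)].

Lemma tpure_bilinear : bilinear_map tpure.
Proof.
split=> [v a u u'|u a v v'].
- rewrite /GRing.add /GRing.scale /= /tpure tens_scaleE tens_addE /=.
  by apply: tens_eqP; exact: Tens_addl.
- rewrite /GRing.add /GRing.scale /= /tpure tens_scaleE tens_addE /=.
  apply: tens_eqP; apply: Tens_trans (Tens_addr _ _ _) _.
  rewrite -cat1s -[X in tens_eq _ X]cat1s.
  apply: Tens_cat; last exact: Tens_refl.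
  by apply: Tens_sym; exact: Tens_scale.
Qed.

Lemma tens_pureE s : \pi_tens s = \sum_(p <- s) tpure p.1 p.2.
Proof.
elim: s => [|[u v] s IH]; first by rewrite big_nil.
by rewrite big_cons -IH /GRing.add /= /tpure tens_addE.
Qed.

(* The map induced on the tensor product by [f]; it is independent of the
   chosen representative (and linear) when [f] is bilinear. *)
Definition tlift (M : lmodType F) (f : U -> V -> M) (x : tens) : M :=
  \sum_(p <- repr x) f p.1 p.2.

Lemma tlift_pi (M : lmodType F) (f : U -> V -> M) s : bilinear_map f ->
  tlift f (\pi_tens s) = \sum_(p <- s) f p.1 p.2.
Proof.
move=> [fl fr].
have fD u u' v : f (u + u') v = f u v + f u' v.
  by have := fl v 1 u u'; rewrite !scale1r.
have f0 v : f 0 v = 0 by apply: (addrI (f 0 v)); rewrite -fD !addr0.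
have fDr u v v' : f u (v + v') = f u v + f u v'.
  by have := fr u 1 v v'; rewrite !scale1r.
have f0r u : f u 0 = 0 by apply: (addrI (f u 0)); rewrite -fDr !addr0.
suff H s1 s2 : tens_eq s1 s2 ->
    \sum_(p <- s1) f p.1 p.2 = \sum_(p <- s2) f p.1 p.2.
  by apply: H; apply: tens_eqE; rewrite reprK.
elim=> {s1 s2} //=.
- by move=> s1 s2 s3 _ -> _ ->.
- by move=> s1 s2 s3 s4 _ h _ h'; rewrite !big_cat /= h h'.
- by move=> s1 s2; rewrite !big_cat /= addrC.
- by move=> v; rewrite !big_cons !big_nil !addr0 /= ?f0 ?fD ?fDr.
- by move=> u u' v; rewrite !big_cons !big_nil !addr0 /= ?f0 ?fD ?fDr.
- by move=> u v v'; rewrite !big_cons !big_nil !addr0 /= ?f0 ?fD ?fDr.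
- move=> a u v; rewrite !big_cons !big_nil !addr0 /=.
  have := fl v a u 0; have := fr u a v 0.
  by rewrite !addr0 f0 f0r !addr0 => -> ->.
Qed.

Lemma tlift_pure (M : lmodType F) (f : U -> V -> M) u v : bilinear_map f ->
  tlift f (tpure u v) = f u v.
Proof. by move=> bf; rewrite tlift_pi // big_seq1. Qed.

Lemma tlift_linear (M : lmodType F) (f : U -> V -> M) : bilinear_map f ->
  linear (tlift f).
Proof.
move=> bf a x y; rewrite -[x]reprK -[y]reprK.
set s := repr x; set t := repr y.
have -> : a *: (\pi_tens s : tens) + (\pi_tens t : tens)
    = \pi_tens (tens_map1 ( *:%R a) s ++ t).
  by rewrite -tens_addE -tens_scaleE.
rewrite !tlift_pi // big_cat /=; congr (_ + _).
rewrite big_map scaler_sumr; apply: eq_bigr => -[u v] _ /=.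
case: bf => fl fr; have := fl v a u 0.
have := fl v (-1) 0 0; rewrite scaler0 addr0 scaleN1r addNr => ->.
by rewrite !addr0.
Qed.

Lemma tens_ind (P : tens -> Prop) :
  P 0 -> (forall x y, P x -> P y -> P (x + y)) ->
  (forall u v, P (tpure u v)) -> forall x, P x.
Proof.
move=> P0 PD Pp x; rewrite -[x]reprK tens_pureE.
by elim: (repr x) => [|p s IH]; rewrite ?big_nil // big_cons; exact: PD.
Qed.

Lemma tlift_param (M N : lmodType F) (f : N -> U -> V -> M) :
  (forall z, bilinear_map (f z)) -> (forall u v, linear (fun z => f z u v)) ->
  forall x, linear (fun z => tlift (f z) x).
Proof.
move=> bf lf x a z w; elim/tens_ind: x => [|x y IH IH'|u v].
- by rewrite !(lin0 (tlift_linear (bf _))) scaler0 addr0.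
- by rewrite !(linD (tlift_linear (bf _))) IH IH' scalerDr addrACA.
- by rewrite !tlift_pure // lf.
Qed.

End Tensor.

Notation "u *t v" := (tpure u v) (at level 40, left associativity).

Section TensorTheory.
Variables (F : fieldType) (V W : lmodType F).

Lemma tpure0l (w : W) : (0 : V) *t w = 0.
Proof.
case: (tpure_bilinear V W) => hl hr.
by have := hl w (-1) 0 0; rewrite /= scaler0 addr0 scaleN1r addNr.
Qed.

Lemma tpure0r (v : V) : v *t (0 : W) = 0.
Proof.
case: (tpure_bilinear V W) => hl hr.
by have := hr v (-1) 0 0; rewrite /= scaler0 addr0 scaleN1r addNr.
Qed.

Lemma tpureDl (v v' : V) (w : W) : (v + v') *t w = v *t w + v' *t w.
Proof.
case: (tpure_bilinear V W) => hl hr.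
by have := hl w 1 v v'; rewrite /= !scale1r.
Qed.

Lemma tpureDr (v : V) (w w' : W) : v *t (w + w') = v *t w + v *t w'.
Proof.
case: (tpure_bilinear V W) => hl hr.
by have := hr v 1 w w'; rewrite /= !scale1r.
Qed.

Lemma tpureZl a (v : V) (w : W) : (a *: v) *t w = a *: (v *t w).
Proof.
case: (tpure_bilinear V W) => hl hr.
by have := hl w a v 0; rewrite tpure0l /= !addr0.
Qed.

Lemma tpureZr a (v : V) (w : W) : v *t (a *: w) = a *: (v *t w).
Proof.
case: (tpure_bilinear V W) => hl hr.
by have := hr v a w 0; rewrite tpure0r /= !addr0.
Qed.

End TensorTheory.

(* A Z-graded vector space is a vector space which is the internal direct sum
   of the images of the projections [gr_pr p], the homogeneous components. *)
Record grmod (F : fieldType) := GrMod {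
  gr_mod :> lmodType F;
  gr_pr : int -> {linear gr_mod -> gr_mod};
  gr_prK : forall p q v, gr_pr p (gr_pr q v) = if p == q then gr_pr q v else 0;
  gr_dec : forall v, exists2 s : seq int, uniq s & v = \sum_(q <- s) gr_pr q v
}.

Definition homog (F : fieldType) (V : grmod F) (p : int) (v : V) : Prop :=
  gr_pr V p v = v.

Definition has_degree (F : fieldType) (V W : grmod F) (d : int)
    (f : V -> W) : Prop :=
  forall p v, homog p v -> homog (p + d) (f v).

(* [hext f] is the additive extension of the map given by [f p] on the
   component of degree [p]. *)
Definition hext (F : fieldType) (V : grmod F) (M : lmodType F)
    (f : int -> V -> M) (v : V) : M :=
  \sum_(p \in [set: int]%classic) f p (gr_pr V p v).

Section Graded.
Variables (F : fieldType) (V : grmod F).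

Lemma gr_pr_homog p v : homog p (gr_pr V p v).
Proof. by rewrite /homog gr_prK eqxx. Qed.

Lemma gr_pr_notin (s : seq int) v p :
  v = \sum_(q <- s) gr_pr V q v -> p \notin s -> gr_pr V p v = 0.
Proof.
move=> -> ps; rewrite linear_sum big_seq big1 // => q qs.
rewrite gr_prK; case: eqP => // pq; by rewrite pq qs in ps.
Qed.

Lemma hextE (M : lmodType F) (f : int -> V -> M) (s : seq int) v :
  (forall p, f p 0 = 0) -> uniq s ->
  (forall p, p \notin s -> gr_pr V p v = 0) ->
  hext f v = \sum_(p <- s) f p (gr_pr V p v).
Proof.
move=> f0 us hs; rewrite /hext.
rewrite [RHS]fsbig_seq //; apply/esym; apply: fsbig_widen => // p /= [_ ps].
by rewrite hs ?f0 //; apply/negP.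
Qed.

Lemma hext_homog (M : lmodType F) (f : int -> V -> M) p v :
  (forall q, f q 0 = 0) -> homog p v -> hext f v = f p v.
Proof.
move=> f0 hv; rewrite (@hextE _ _ [:: p]) ?big_seq1 ?hv // => q.
rewrite inE => /negbTE qp; by rewrite -hv gr_prK qp.
Qed.

Lemma hext_linear (M : lmodType F) (f : int -> V -> M) :
  (forall p, linear (f p)) -> linear (hext f).
Proof.
move=> lf a v w.
have f0 p : f p 0 = 0.
  by have := lf p (-1) 0 0; rewrite scaler0 addr0 scaleN1r addNr.
have [s us hs] := gr_dec v; have [t ut ht] := gr_dec w.
have hv p : p \notin undup (s ++ t) -> gr_pr V p v = 0.
  by rewrite mem_undup mem_cat negb_or => /andP[ps _]; exact: gr_pr_notin hs ps.
have hw p : p \notin undup (s ++ t) -> gr_pr V p w = 0.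
  by rewrite mem_undup mem_cat negb_or => /andP[_ ps]; exact: gr_pr_notin ht ps.
rewrite !(@hextE _ f (undup (s ++ t))) ?undup_uniq //; last first.
  by move=> p ps; rewrite linearP hv // hw // scaler0 addr0.
rewrite scaler_sumr -big_split; apply: eq_bigr => p _ /=.
by rewrite linearP lf.
Qed.

Lemma homog_ind (P : V -> Prop) :
  P 0 -> (forall x y, P x -> P y -> P (x + y)) ->
  (forall p v, homog p v -> P v) -> forall v, P v.
Proof.
move=> P0 PD Ph v; have [s _ ->] := gr_dec v.
elim: s => [|p s IH]; first by rewrite big_nil.
by rewrite big_cons; apply: PD => //; exact: Ph (gr_pr_homog _ _).
Qed.

End Graded.

Section HomogTheory.
Variables (F : fieldType) (V : grmod F).

Lemma homog0 p : homog p (0 : V). Proof. exact: linear0. Qed.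

Lemma homogD p (v w : V) : homog p v -> homog p w -> homog p (v + w).
Proof. by rewrite /homog linearD => -> ->. Qed.

Lemma homogZ p a (v : V) : homog p v -> homog p (a *: v).
Proof. by rewrite /homog linearZ /= => ->. Qed.

Lemma homogN p (v : V) : homog p v -> homog p (- v).
Proof. by rewrite /homog linearN => ->. Qed.

Lemma homog_sum p (I : Type) (s : seq I) (P : pred I) (f : I -> V) :
  (forall i, P i -> homog p (f i)) -> homog p (\sum_(i <- s | P i) f i).
Proof.
move=> h; elim/big_ind: _ => //; [exact: homog0 | move=> x y; exact: homogD].
Qed.

End HomogTheory.

Section GradedTensor.
Variables (F : fieldType) (V W : grmod F).

Definition gtens_fun (q : int) (v : V) (w : W) : tens V W :=
  hext (fun p vp => vp *t gr_pr W (q - p) w) v.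

Lemma gtens_fun_bilinear q : bilinear_map (gtens_fun q).
Proof.
split=> [w|v].
  by apply: hext_linear => p a v v'; case: (tpure_bilinear V W) => h _; exact: h.
move=> a w w'; rewrite /gtens_fun.
have [s us hs] := gr_dec v.
have hv p : p \notin s -> gr_pr V p v = 0 by exact: gr_pr_notin.
rewrite !(@hextE _ _ _ _ s) //; try by move=> p; exact: tpure0l.
rewrite scaler_sumr -big_split.
by apply: eq_bigr => p _; rewrite linearP tpureDr tpureZr.
Qed.

Definition gtens_pr (q : int) : tens V W -> tens V W := tlift (gtens_fun q).

Lemma gtens_pr_linear q : linear (gtens_pr q).
Proof. exact: tlift_linear (gtens_fun_bilinear q). Qed.

HB.instance Definition _ q :=
  GRing.isLinear.Build F (tens V W) (tens V W) _ (gtens_pr q) (gtens_pr_linear q).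

Lemma gtens_prE q p r (v : V) (w : W) : homog p v -> homog r w ->
  gtens_pr q (v *t w) = if q == p + r then v *t w else 0.
Proof.
move=> hv hw; rewrite /gtens_pr tlift_pure; last exact: gtens_fun_bilinear.
rewrite /gtens_fun (hext_homog _ hv); last by move=> ?; exact: tpure0l.
have -> : gr_pr W (q - p) w = if q - p == r then w else 0.
  by rewrite -{1}hw gr_prK hw.
by rewrite subr_eq addrC; case: eqP => _; rewrite ?tpure0r.
Qed.

Lemma gtens_ind (P : tens V W -> Prop) :
  P 0 -> (forall x y, P x -> P y -> P (x + y)) ->
  (forall p q v w, homog p v -> homog q w -> P (v *t w)) -> forall x, P x.
Proof.
move=> P0 PD Ph; apply: tens_ind => // v w.
elim/homog_ind: v => [|v v' IH IH'|p v hv]; first by rewrite tpure0l.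
  by rewrite tpureDl; exact: PD.
elim/homog_ind: w => [|w w' IH IH'|q w hw]; first by rewrite tpure0r.
  by rewrite tpureDr; exact: PD.
exact: Ph hv hw.
Qed.

Lemma gtens_prK p q x :
  gtens_pr p (gtens_pr q x) = if p == q then gtens_pr q x else 0.
Proof.
elim/gtens_ind: x => [|x y IH IH'|r s v w hv hw].
- by rewrite !linear0; case: ifP.
- by rewrite !linearD /= IH IH'; case: ifP => // _; rewrite addr0.
- rewrite (gtens_prE _ hv hw); case: (q =P r + s) => [->|_].
    by rewrite (gtens_prE _ hv hw).
  by rewrite linear0; case: ifP.
Qed.

Lemma gtens_dec x : exists2 s : seq int, uniq s & x = \sum_(q <- s) gtens_pr q x.
Proof.
suff [s hs] : exists s : seq int, forall t, uniq t -> {subset s <= t} ->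
    x = \sum_(q <- t) gtens_pr q x.
  exists (undup s); rewrite ?undup_uniq //; apply: hs; rewrite ?undup_uniq //.
  by move=> p; rewrite mem_undup.
elim/gtens_ind: x => [|x y [s hs] [t ht]|r s v w hv hw].
- by exists [::] => t _ _; rewrite big1 // => q _; rewrite linear0.
- exists (s ++ t) => r ur hr.
  have sr : {subset s <= r} by move=> p ps; apply: hr; rewrite mem_cat ps.
  have tr : {subset t <= r} by move=> p pt; apply: hr; rewrite mem_cat pt orbT.
  rewrite [LHS](congr2 +%R (hs r ur sr) (ht r ur tr)).
  by rewrite -big_split; apply: eq_bigr => q _; rewrite linearD.
- exists [:: r + s] => t ut ht.
  rewrite (bigD1_seq (r + s)) ?ht ?inE //= (gtens_prE _ hv hw) eqxx.
  rewrite big1 ?addr0 // => q /negbTE qrs.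
  by rewrite (gtens_prE _ hv hw) qrs.
Qed.

Definition gtens : grmod F := GrMod gtens_prK gtens_dec.

Lemma homog_tpure p q (v : V) (w : W) : homog p v -> homog q w ->
  @homog F gtens (p + q) (v *t w).
Proof. by move=> hv hw; rewrite /homog /= (gtens_prE _ hv hw) eqxx. Qed.

Lemma gtens_homog_ind p (P : gtens -> Prop) :
  P 0 -> (forall x y, P x -> P y -> P (x + y)) ->
  (forall q r (v : V) (w : W), p = q + r -> homog q v -> homog r w -> P (v *t w)) ->
  forall x : gtens, homog p x -> P x.
Proof.
move=> P0 PD Pp x <-; rewrite -[gr_pr _ _ _]/(gtens_pr p x).
elim/gtens_ind: x => [|x y hx hy|q r v w hv hw].
- by rewrite linear0.
- by rewrite linearD; exact: PD.
- by rewrite (gtens_prE _ hv hw); case: eqP => // e; exact: Pp e hv hw.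
Qed.

End GradedTensor.

(* v |-> (-1)^(d |v|) v *)
Definition ksgn (F : fieldType) (V : grmod F) (d : int) (v : V) : V :=
  hext (fun p vp => (-1) ^ (d * p) *: vp) v.

Lemma ksgn_linear (F : fieldType) (V : grmod F) d : linear (@ksgn F V d).
Proof.
apply: hext_linear => p a v w.
by rewrite scalerDr !scalerA mulrC.
Qed.

HB.instance Definition _ (F : fieldType) (V : grmod F) d :=
  GRing.isLinear.Build F V V _ (@ksgn F V d) (@ksgn_linear F V d).

Lemma ksgn_homog (F : fieldType) (V : grmod F) d p (v : V) :
  homog p v -> ksgn d v = (-1) ^ (d * p) *: v.
Proof. by move=> hv; rewrite /ksgn (hext_homog _ hv) // => q; rewrite scaler0. Qed.

(* (f (x) g)(u (x) v) = (-1)^(|g| |u|) f u (x) g v, where d = |g|. *)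
Definition tensm (F : fieldType) (U V U' V' : grmod F) (d : int)
    (f : U -> U') (g : V -> V') : gtens U V -> gtens U' V' :=
  tlift (fun u v => f (ksgn d u) *t g v).

Lemma tensm_bilinear (F : fieldType) (U V U' V' : grmod F) d
    (f : {linear U -> U'}) (g : {linear V -> V'}) :
  bilinear_map (fun u v => f (ksgn d u) *t g v).
Proof.
split=> [v a u u'|u a v v']; rewrite !linearP.
  by rewrite tpureDl tpureZl.
by rewrite tpureDr tpureZr.
Qed.

Lemma tensm_linear (F : fieldType) (U V U' V' : grmod F) d
    (f : {linear U -> U'}) (g : {linear V -> V'}) : linear (tensm d f g).
Proof. exact: tlift_linear (tensm_bilinear d f g). Qed.

Lemma tensm_pure (F : fieldType) (U V U' V' : grmod F) d
    (f : {linear U -> U'}) (g : {linear V -> V'}) p u v :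
  homog p u -> tensm d f g (u *t v) = (-1) ^ (d * p) *: (f u *t g v).
Proof.
move=> hu; rewrite /tensm (tlift_pure _ _ (tensm_bilinear d f g)).
by rewrite (ksgn_homog d hu) linearZ tpureZl.
Qed.

(* u (x) v |-> (-1)^(|u| |v|) v (x) u *)
Definition twist (F : fieldType) (U V : grmod F) : gtens U V -> gtens V U :=
  tlift (fun u v => hext (fun p up => ksgn p v *t up) u).

Lemma twist_bilinear (F : fieldType) (U V : grmod F) :
  bilinear_map (fun (u : U) (v : V) => hext (fun p up => ksgn p v *t up) u).
Proof.
split=> [v|u a v v'].
  by apply: hext_linear => p a u u'; rewrite tpureDr tpureZr.
have [s us hs] := gr_dec u.
have hu p : p \notin s -> gr_pr U p u = 0 by exact: gr_pr_notin.
rewrite !(@hextE _ _ _ _ s) //; try by move=> p; exact: tpure0r.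
rewrite scaler_sumr -big_split.
by apply: eq_bigr => p _; rewrite linearP tpureDl tpureZl.
Qed.

Lemma twist_pure (F : fieldType) (U V : grmod F) p q (u : U) (v : V) :
  homog p u -> homog q v -> twist (u *t v) = (-1) ^ (p * q) *: (v *t u).
Proof.
move=> hu hv; rewrite /twist (tlift_pure _ _ (twist_bilinear U V)).
rewrite (hext_homog _ hu); last by move=> ?; exact: tpure0r.
by rewrite (ksgn_homog p hv) tpureZl.
Qed.

Definition tassoc (F : fieldType) (U V W : grmod F) :
    gtens (gtens U V) W -> gtens U (gtens V W) :=
  tlift (fun x w => tlift (fun u v => u *t ((v *t w) : gtens V W)) x).

Lemma tassoc_pure (F : fieldType) (U V W : grmod F) (u : U) (v : V) (w : W) :
  tassoc ((u *t v : gtens U V) *t w) = u *t (v *t w : gtens V W).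
Proof.
have bl w' : bilinear_map (fun (u : U) (v : V) => u *t (v *t w' : gtens V W)).
  by split=> [v'|u'] a x y; rewrite ?tpureDl ?tpureZl // tpureDr tpureZr.
rewrite /tassoc tlift_pure; first by rewrite tlift_pure.
split=> [w'|x a y z]; first exact: tlift_linear.
apply: (tlift_param (f := fun w u v => u *t (v *t w : gtens V W))) => // u' v' b y' z'.
by rewrite !tpureDr !tpureZr.
Qed.

Record complex (F : fieldType) := Complex {
  cx_mod :> grmod F;
  cx_d : {linear cx_mod -> cx_mod};
  cx_d_degree : has_degree (-1) cx_d;
  cx_d_square : forall v, cx_d (cx_d v) = 0
}.

Record dgcoalg (F : fieldType) := DGCoalg {
  dgc_cx :> complex F;
  coprod : {linear dgc_cx -> gtens dgc_cx dgc_cx};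
  coprod_degree : has_degree 0 coprod;
  coprod_coassoc : forall c,
    tassoc (tensm 0 coprod id (coprod c)) = tensm 0 id coprod (coprod c);
  coprod_coder : forall c, coprod (cx_d dgc_cx c) =
    tensm 0 (cx_d dgc_cx) id (coprod c) + tensm (-1) id (cx_d dgc_cx) (coprod c)
}.

Definition cocommutative (F : fieldType) (C : dgcoalg F) : Prop :=
  forall c, twist (coprod C c) = coprod C c.

Record hretract (F : fieldType) (C V : complex F) := HRetract {
  hr_i : {linear V -> C};
  hr_p : {linear C -> V};
  hr_K : {linear C -> C};
  hr_i_degree : has_degree 0 hr_i;
  hr_p_degree : has_degree 0 hr_p;
  hr_K_degree : has_degree 1 hr_K;
  hr_i_chain : forall v, hr_i (cx_d V v) = cx_d C (hr_i v);
  hr_p_chain : forall c, hr_p (cx_d C c) = cx_d V (hr_p c);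
  hr_pi : forall v, hr_p (hr_i v) = v;
  hr_ip : forall c, hr_i (hr_p c) - c = cx_d C (hr_K c) + hr_K (cx_d C c)
}.

Section Desuspension.
Variables (F : fieldType) (V : grmod F).

Lemma desusp_prK (p q : int) (v : V) :
  gr_pr V (p + 1) (gr_pr V (q + 1) v) = if p == q then gr_pr V (q + 1) v else 0.
Proof. by rewrite gr_prK (inj_eq (addIr 1)). Qed.

Lemma desusp_dec (v : V) :
  exists2 s : seq int, uniq s & v = \sum_(q <- s) gr_pr V (q + 1) v.
Proof.
have [s us hs] := gr_dec v; exists [seq q - 1 | q <- s].
  by rewrite map_inj_uniq //; exact: addIr.
by rewrite big_map {1}hs; apply: eq_bigr => q _; rewrite subrK.
Qed.

(* Same underlying space as [V], with (s^-1 V)_q = V_(q+1). *)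
Definition desusp : grmod F := GrMod desusp_prK desusp_dec.

Definition sdown (v : V) : desusp := v.
Definition sraise (v : desusp) : V := v.

HB.instance Definition _ := GRing.isLinear.Build F V desusp _ sdown (fun _ _ _ => erefl).
HB.instance Definition _ := GRing.isLinear.Build F desusp V _ sraise (fun _ _ _ => erefl).

Lemma sdown_degree : has_degree (-1) sdown.
Proof. by move=> p v hv; rewrite /homog /= subrK. Qed.

Lemma sraise_degree : has_degree 1 sraise.
Proof. by []. Qed.

End Desuspension.

Section GroundField.
Variable F : fieldType.

Definition gr_unit_pr (p : int) (a : F^o) : F^o := if p == 0 then a else 0.

Lemma gr_unit_pr_linear p : linear (gr_unit_pr p).
Proof.
by move=> a x y; rewrite /gr_unit_pr; case: ifP => // _; rewrite scaler0 addr0.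
Qed.

HB.instance Definition _ p :=
  GRing.isLinear.Build F F^o F^o _ (gr_unit_pr p) (gr_unit_pr_linear p).

Lemma gr_unit_prK p q a :
  gr_unit_pr p (gr_unit_pr q a) = if p == q then gr_unit_pr q a else 0.
Proof.
rewrite /gr_unit_pr; case: (p =P q) => [->|pq]; first by case: (q == 0).
by case: (p =P 0) => // p0; case: (q =P 0) => // q0; case: pq; rewrite p0 q0.
Qed.

Lemma gr_unit_dec a : exists2 s : seq int, uniq s & a = \sum_(q <- s) gr_unit_pr q a.
Proof. by exists [:: 0]; rewrite // big_seq1. Qed.

Definition gr_unit : grmod F := GrMod gr_unit_prK gr_unit_dec.

End GroundField.

Fixpoint tpow (F : fieldType) (W : grmod F) (n : nat) : grmod F :=
  if n is m.+1 then gtens W (tpow W m) else gr_unit F.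

Lemma tpow_ind (F : fieldType) (W : grmod F) n (P : tpow W n.+1 -> Prop) :
  P 0 -> (forall x y, P x -> P y -> P (x + y)) ->
  (forall (w : W) (t : tpow W n), P (w *t t)) -> forall t, P t.
Proof. by move=> P0 PD Pp; exact: tens_ind. Qed.

Section CompleteTensorAlgebra.
Variables (F : fieldType) (W : grmod F).

(* Elements of prod_n W^(x)n, where W^(x)(n+1) = W (x) W^(x)n, W^(x)0 = F. *)
Definition that : Type := forall n, tpow W n.

HB.instance Definition _ := gen_eqMixin that.
HB.instance Definition _ := gen_choiceMixin that.

Definition that_add (x y : that) : that := fun n => x n + y n.
Definition that_opp (x : that) : that := fun n => - x n.
Definition that_zero : that := fun n => 0.
Definition that_scale (a : F) (x : that) : that := fun n => a *: x n.

Lemma that_addA : associative that_add.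
Proof. by move=> x y z; apply: functional_extensionality_dep => n; exact: addrA. Qed.
Lemma that_addC : commutative that_add.
Proof. by move=> x y; apply: functional_extensionality_dep => n; exact: addrC. Qed.
Lemma that_add0 : left_id that_zero that_add.
Proof. by move=> x; apply: functional_extensionality_dep => n; exact: add0r. Qed.
Lemma that_addN : left_inverse that_zero that_opp that_add.
Proof. by move=> x; apply: functional_extensionality_dep => n; exact: addNr. Qed.

HB.instance Definition _ :=
  GRing.isZmodule.Build that that_addA that_addC that_add0 that_addN.

Lemma that_scaleA a b (x : that) :
  that_scale a (that_scale b x) = that_scale (a * b) x.
Proof. by apply: functional_extensionality_dep => n; exact: scalerA. Qed.
Lemma that_scale1 : left_id 1 that_scale.
Proof. by move=> x; apply: functional_extensionality_dep => n; exact: scale1r. Qed.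
Lemma that_scaleDr : right_distributive that_scale +%R.
Proof. by move=> a x y; apply: functional_extensionality_dep => n; exact: scalerDr. Qed.
Lemma that_scaleDl (x : that) : {morph that_scale^~ x : a b / a + b}.
Proof. by move=> a b; apply: functional_extensionality_dep => n; exact: scalerDl. Qed.

HB.instance Definition _ := GRing.Zmodule_isLmodule.Build F that
  that_scaleA that_scale1 that_scaleDr that_scaleDl.

Definition thomog (q : int) (x : that) : Prop := forall n, homog q (x n).

Definition tone : that := fun n =>
  match n return tpow W n with 0%N => (1 : F^o) | _ => 0 end.

Definition tgen (w : W) : that := fun n =>
  match n return tpow W n with 1%N => w *t (1 : F^o) | _ => 0 end.

Definition tcons (w : W) (x : that) : that := fun n =>
  match n return tpow W n with 0%N => 0 | m.+1 => w *t x m end.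

(* The product t . y for t in the n-th tensor power. *)
Fixpoint tact (y : that) (n : nat) : tpow W n -> that :=
  match n return tpow W n -> that with
  | 0%N => fun c => (c : F) *: y
  | m.+1 => tlift (fun w (t : tpow W m) => tcons w (tact y t))
  end.

(* Component n of [tact y t] vanishes when t has length m > n. *)
Definition tmul (x y : that) : that := fun n => \sum_(m < n.+1) tact y (x m) n.

(* The inclusion t |-> t . 1 of the n-th tensor power. *)
Definition tincl (n : nat) (t : tpow W n) : that := tact tone t.

Definition tproj (n : nat) (x : that) : that := fun m =>
  if m == n then x m else 0.

Lemma that_ext (x y : that) : (forall n, x n = y n) -> x = y.
Proof. exact: functional_extensionality_dep. Qed.

Lemma that_linE a (x y : that) n : (a *: x + y) n = a *: x n + y n.
Proof. by []. Qed.

Lemma that_sumE (I : Type) (s : seq I) (P : pred I) (f : I -> that) n :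
  (\sum_(i <- s | P i) f i) n = \sum_(i <- s | P i) f i n.
Proof. by elim/big_rec2: _ => // i y1 y2 _ <-. Qed.

Lemma tgen_linear : linear tgen.
Proof.
move=> a w w'; apply: that_ext => -[|[|n]].
- by rewrite that_linE /= scaler0 addr0.
- by rewrite that_linE /= tpureDl tpureZl.
- by rewrite that_linE /= scaler0 addr0.
Qed.

Lemma tcons_bilinear : bilinear_map tcons.
Proof.
split=> [x a w w'|w a x x']; apply: that_ext => -[|n].
- by rewrite that_linE /= scaler0 addr0.
- by rewrite that_linE /= tpureDl tpureZl.
- by rewrite that_linE /= scaler0 addr0.
- by rewrite that_linE /= tpureDr tpureZr.
Qed.

Lemma tact_linear y n : linear (@tact y n).
Proof.
elim: n => [|n IH] /=.
  by move=> a c c'; rewrite scalerDl -scalerA.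
apply: tlift_linear; split=> [t|w a t t']; first exact: tcons_bilinear.1.
by rewrite IH tcons_bilinear.2.
Qed.

Lemma tcons_tact_bilinear y n :
  bilinear_map (fun w (t : tpow W n) => tcons w (tact y t)).
Proof.
split=> [t|w a t t']; first exact: tcons_bilinear.1.
by rewrite tact_linear tcons_bilinear.2.
Qed.

Lemma tact_pure y n w (t : tpow W n) :
  tact y (w *t t : tpow W n.+1) = tcons w (tact y t).
Proof. by rewrite /= tlift_pure //; exact: tcons_tact_bilinear. Qed.

Lemma tact_linear_l n (t : tpow W n) : linear (fun y => tact y t).
Proof.
elim: n t => [|n IH] t /=.
  by move=> a y y'; rewrite scalerDr !scalerA mulrC.
apply: (tlift_param (f := fun y w (t : tpow W n) => tcons w (tact y t))).
  by move=> y; exact: tcons_tact_bilinear.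
by move=> w t' a y y'; rewrite IH tcons_bilinear.2.
Qed.

Lemma tact_low y m n (t : tpow W m) : (n < m)%N -> tact y t n = 0.
Proof.
elim: m n t => [//|m IH] n t nm; elim/tpow_ind: t => [|t t' h h'|w t].
- by rewrite (lin0 (@tact_linear y m.+1)).
- by rewrite (linD (@tact_linear y m.+1)) -[LHS]/(tact y t n + tact y t' n) h h' addr0.
- rewrite tact_pure; case: n nm => //= n nm.
  by rewrite IH // tpure0r.
Qed.

Lemma tmul_bilinear : bilinear_map tmul.
Proof.
split=> [y a x x'|x a y y']; apply: that_ext => n.
  rewrite -[RHS]/(a *: tmul x y n + tmul x' y n) /tmul scaler_sumr -big_split.
  by apply: eq_bigr => m _; rewrite -[LHS]/(tact y (a *: x m + x' m) n) tact_linear.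
rewrite -[RHS]/(a *: tmul x y n + tmul x y' n) /tmul scaler_sumr -big_split.
by apply: eq_bigr => m _; rewrite tact_linear_l.
Qed.

Lemma tmul1l x : tmul tone x = x.
Proof.
apply: that_ext => n; rewrite /tmul big_ord_recl /= big1 => [|m _].
  by rewrite scale1r addr0.
by rewrite (lin0 (@tlift_linear _ _ _ _ _ (tcons_tact_bilinear _ _))).
Qed.

Lemma tincl_comp n (t : tpow W n) : tincl t n = t.
Proof.
elim: n t => [|n IH] t.
  rewrite /tincl /= -[LHS]/((t : F) *: (1 : F^o)); exact: mulr1.
elim/tpow_ind: t => [|t t' h h'|w t].
- by rewrite /tincl (lin0 (@tact_linear tone n.+1)).
- by rewrite /tincl (linD (@tact_linear tone n.+1)); congr (_ + _).
- by rewrite /tincl tact_pure /= -/(tincl t) IH.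
Qed.

Lemma tincl_comp0 m n (t : tpow W n) : m != n -> tincl t m = 0.
Proof.
elim: n m t => [|n IH] m t.
  case: m => // m _; rewrite /tincl /=; exact: scaler0.
move=> mn; elim/tpow_ind: t => [|t t' h h'|w t].
- by rewrite /tincl (lin0 (@tact_linear tone n.+1)).
- rewrite /tincl (linD (@tact_linear tone n.+1)).
  by rewrite -[LHS]/(tincl t m + tincl t' m) h h' addr0.
- rewrite /tincl tact_pure; case: m mn => //= m mn.
  by rewrite -/(tincl t) IH ?tpure0r.
Qed.

Lemma tmul1r x : tmul x tone = x.
Proof.
apply: that_ext => n; rewrite /tmul big_ord_recr /= big1 => [|m _].
  by rewrite -/(tincl (x n)) tincl_comp add0r.
by rewrite -/(tincl (x m)) tincl_comp0 // gtn_eqF.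
Qed.

Lemma tmul_cons w x y : tmul (tcons w x) y = tcons w (tmul x y).
Proof.
apply: that_ext => n; rewrite /tmul big_ord_recl /= scale0r.
rewrite -[(0 : that) n]/(0 : tpow W n) add0r; case: n => [|n] /=.
  by rewrite big_ord0.
have lf : linear (fun t : tpow W n => w *t t).
  by move=> a t t'; rewrite tpureDr tpureZr.
rewrite [RHS](big_morph _ (linD lf) (lin0 lf)).
by apply: eq_bigr => m _; rewrite -[tlift _ _]/(tact y (w *t x m : tpow W _.+1)) tact_pure.
Qed.

Lemma tmul_gen w x : tmul (tgen w) x = tcons w x.
Proof.
have -> : tgen w = tcons w tone.
  by apply: that_ext => -[|[|n]] //=; rewrite tpure0r.
by rewrite tmul_cons tmul1l.
Qed.

Lemma tmul_tact n (t : tpow W n) y z : tmul (tact y t) z = tact (tmul y z) t.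
Proof.
elim: n t => [|n IH] t; first by rewrite /= (linZ (tmul_bilinear.1 z)).
elim/tpow_ind: t => [|t t' h h'|w t].
- by rewrite !(lin0 (@tact_linear _ n.+1)) (lin0 (tmul_bilinear.1 z)).
- by rewrite !(linD (@tact_linear _ n.+1)) (linD (tmul_bilinear.1 z)) h h'.
- by rewrite !tact_pure tmul_cons IH.
Qed.

Lemma tmulA : associative tmul.
Proof.
move=> x y z; apply: that_ext => n.
transitivity (\sum_(m < n.+1) \sum_(k < n.+1) tact z (tact y (x m) k) n).
  by apply: eq_bigr => m _; rewrite -tmul_tact.
rewrite exchange_big -[RHS]/(\sum_(k < n.+1) tact z (tmul x y k) n).
apply: eq_bigr => k _.
have lz := @tact_linear z k.
have lf : linear (fun t : tpow W k => tact z t n).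
  by move=> a t t'; rewrite lz.
rewrite -(big_morph _ (linD lf) (lin0 lf)); congr (tact z _ n).
rewrite /tmul [RHS](big_ord_widen n.+1 (fun m => tact y (x m) k)) //.
rewrite [RHS]big_mkcond; apply: eq_bigr => m _.
by case: ltnP => // km; rewrite tact_low.
Qed.

(* [thatder D] is the continuous derivation of degree -1 extending [D], where
   [D w] has no component of length 0; [tder] is its restriction to the n-th
   tensor power, whose values only have components of length at least n. *)
Fixpoint tder (D : W -> that) (n : nat) : tpow W n -> that :=
  match n return tpow W n -> that with
  | 0%N => fun=> 0
  | m.+1 => tlift (fun w (t : tpow W m) =>
      tmul (D w) (tincl t) + tcons (ksgn (-1) w) (tder D t))
  end.

Definition thatder (D : W -> that) (x : that) : that := fun n =>
  \sum_(m < n.+1) tder D (x m) n.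

Lemma thomog_gen p w : homog p w -> thomog p (tgen w).
Proof.
move=> hw [|[|n]]; try exact: homog0.
by rewrite -[p]addr0; apply: homog_tpure => //; rewrite /homog /= /gr_unit_pr eqxx.
Qed.

Lemma thomog_cons p q w x : homog p w -> thomog q x -> thomog (p + q) (tcons w x).
Proof. by move=> hw hx [|n]; [exact: homog0 | exact: homog_tpure]. Qed.

Lemma thomog_tact p q n (t : tpow W n) y :
  homog p t -> thomog q y -> thomog (p + q) (tact y t).
Proof.
move=> ht hy; elim: n p t ht => [|n IH] p t ht.
  move=> m; move: ht; rewrite /homog /= /gr_unit_pr; case: (p =P 0) => [->|_] ht.
    by rewrite add0r; exact/homogZ/hy.
  by rewrite -ht scale0r; exact: homog0.
move: t ht; apply: gtens_homog_ind => [|t t' h h'|r s w t e hw ht].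
- rewrite (lin0 (@tact_linear y n.+1)) => m; exact: homog0.
- rewrite (linD (@tact_linear y n.+1)) => m; exact: homogD.
- by rewrite tact_pure e -addrA; apply: thomog_cons => //; exact: IH.
Qed.

Lemma thomog_mul p q x y : thomog p x -> thomog q y -> thomog (p + q) (tmul x y).
Proof. by move=> hx hy n; apply: homog_sum => m _; exact: thomog_tact. Qed.

Definition tlen (k : nat) (x : that) : Prop := forall n, n != k -> x n = 0.

Lemma tlen_gen w : tlen 1 (tgen w).
Proof. by move=> [|[|n]]. Qed.

Lemma tlen_tact k n (t : tpow W n) y : tlen k y -> tlen (n + k) (tact y t).
Proof.
move=> hy; elim: n t => [|n IH] t m mk; first by rewrite /= -[LHS]/(_ *: y m) hy ?scaler0.
elim/tpow_ind: t => [|t t' h h'|w t].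
- by rewrite (lin0 (@tact_linear y n.+1)).
- by rewrite (linD (@tact_linear y n.+1)) -[LHS]/(tact y t m + tact y t' m) h h' addr0.
- by rewrite tact_pure; case: m mk => //= m mk; rewrite IH ?tpure0r.
Qed.

Lemma tlen_mul j k x y : tlen j x -> tlen k y -> tlen (j + k) (tmul x y).
Proof.
move=> hx hy n nk; rewrite /tmul big1 // => m _.
have [mj|mj] := eqVneq (nat_of_ord m) j; first by apply: (tlen_tact _ hy); rewrite mj.
by rewrite hx // (lin0 (@tact_linear y m)).
Qed.

Lemma tact_local y y' k n (t : tpow W k) : (k <= n)%N ->
  y (n - k)%N = y' (n - k)%N -> tact y t n = tact y' t n.
Proof.
elim: k n t => [|k IH] n t.
  by move=> _ e; rewrite subn0 in e; rewrite /= -[LHS]/(_ *: y n) e.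
case: n => // n kn e; elim/tpow_ind: t => [|t t' h h'|w t].
- by rewrite !(lin0 (@tact_linear _ k.+1)).
- rewrite !(linD (@tact_linear _ k.+1)).
  by rewrite -[LHS]/(tact y t n.+1 + tact y t' n.+1) h h'.
- by rewrite !tact_pure /= (IH n).
Qed.

Section Derivation.
Variables (D : W -> that) (lD : linear D) (D0 : forall w, D w 0%N = 0).

Lemma tder_linear n : linear (@tder D n).
Proof.
elim: n => [|n IH] /=; first by move=> a c c'; rewrite scaler0 addr0.
apply: tlift_linear; split=> [t|w a t t'] /=.
  move=> a w w'; rewrite lD tmul_bilinear.1 linearP tcons_bilinear.1.
  by rewrite scalerDr addrACA.
rewrite IH /tincl tact_linear tmul_bilinear.2 tcons_bilinear.2.
by rewrite scalerDr addrACA.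
Qed.

Lemma tder_pure n w (t : tpow W n) : tder D (w *t t : tpow W n.+1) =
  tmul (D w) (tincl t) + tcons (ksgn (-1) w) (tder D t).
Proof.
rewrite /= tlift_pure //; split=> [t'|w' a t' t''] /=.
  move=> a v v'; rewrite lD tmul_bilinear.1 linearP tcons_bilinear.1.
  by rewrite scalerDr addrACA.
rewrite tder_linear /tincl tact_linear tmul_bilinear.2 tcons_bilinear.2.
by rewrite scalerDr addrACA.
Qed.

Lemma thatder1 : thatder D tone = 0.
Proof.
apply: that_ext => n; rewrite /thatder big1 // => -[[|m] hm] _ //=.
exact: (congr1 (fun z : that => z n) (lin0 (@tder_linear m.+1))).
Qed.

Lemma thatder_cons w x :
  thatder D (tcons w x) = tmul (D w) x + tcons (ksgn (-1) w) (thatder D x).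
Proof.
apply: that_ext => -[|n]; rewrite -[RHS]/(tmul (D w) x _ + tcons _ _ _).
  rewrite /thatder /tmul !big_ord_recl !big_ord0 /= D0 scale0r.
  by rewrite -[RHS]/((0 + 0) + 0) !addr0.
rewrite {1}/thatder big_ord_recl /= add0r.
transitivity (\sum_(m < n.+1) ((tmul (D w) (tincl (x m)) n.+1 : tpow W n.+1)
    + ksgn (-1) w *t tder D (x m) n)).
  apply: eq_bigr => m _.
  exact: (congr1 (fun z : that => z n.+1) (tder_pure w (x m))).
rewrite big_split; congr (_ + _); last first.
  have lf : linear (fun t : tpow W n => ksgn (-1) w *t t).
    by move=> a t t'; rewrite tpureDr tpureZr.
  by rewrite -(big_morph _ (linD lf) (lin0 lf)).
transitivity (tmul (D w) (\sum_(m < n.+1) tincl (x m)) n.+1).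
  have lf := tmul_bilinear.2 (D w).
  by rewrite (big_morph _ (linD lf) (lin0 lf)) that_sumE.
rewrite /tmul.
apply: eq_bigr => -[[|k] kn] _; first by rewrite /= D0 !scale0r.
apply: (@tact_local (\sum_(m < n.+1) tincl (x m)) x k.+1 n.+1 (D w k.+1)) => //.
rewrite subSS that_sumE.
have kn1 : (n - k < n.+1)%N by rewrite ltnS leq_subr.
rewrite (bigD1 (Ordinal kn1)) //= tincl_comp big1 ?addr0 // => m hm.
by rewrite tincl_comp0 // eq_sym.
Qed.

Lemma thatder_gen w : thatder D (tgen w) = D w.
Proof.
have -> : tgen w = tcons w tone.
  by apply: that_ext => -[|[|n]] //=; rewrite tpure0r.
by rewrite thatder_cons thatder1 tmul1r (lin0 (tcons_bilinear.2 _)) addr0.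
Qed.

End Derivation.

(* The free Lie algebra: the smallest subspace containing the generators and
   closed under the graded commutator of homogeneous elements. *)
Inductive free_lie : that -> Prop :=
| Lie_gen w : free_lie (tgen w)
| Lie_zero : free_lie 0
| Lie_add x y : free_lie x -> free_lie y -> free_lie (x + y)
| Lie_scale a x : free_lie x -> free_lie (a *: x)
| Lie_bracket p q x y : thomog p x -> thomog q y ->
    free_lie x -> free_lie y ->
    free_lie (tmul x y - (-1) ^ (p * q) *: tmul y x).

(* L^n(W) consists of the elements of L(W) concentrated in length n. *)
Definition complete_free_lie (x : that) : Prop :=
  x 0%N = 0 /\ forall n, free_lie (tproj n x).

End CompleteTensorAlgebra.

Inductive pbtree := Leaf | Node of pbtree & pbtree.

HB.instance Definition _ := gen_eqMixin pbtree.

Fixpoint leaves (T : pbtree) : nat :=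
  if T is Node l r then (leaves l + leaves r)%N else 1%N.

Fixpoint trees_rec (fuel k : nat) : seq pbtree :=
  if fuel is n.+1 then
    if k == 1%N then [:: Leaf] else
    flatten [seq [seq Node l r | l <- trees_rec n i, r <- trees_rec n (k - i)]
            | i <- iota 1 k.-1]
  else [::].

Definition trees (k : nat) : seq pbtree := trees_rec k k.

Lemma leaves_gt0 T : (0 < leaves T)%N.
Proof. by elim: T => //= l hl r hr; rewrite addn_gt0 hl. Qed.

Lemma mem_trees_rec n k T : (k <= n)%N ->
  (T \in trees_rec n k) = (leaves T == k).
Proof.
elim: n k T => [|n IH] k T kn /=.
  by move: kn; rewrite leqn0 => /eqP->; rewrite eqn0Ngt leaves_gt0.
case: (k =P 1%N) => [->|/eqP k1].
  rewrite inE; case: T => [|l r] /=; first by rewrite eqxx.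
  have := leaves_gt0 l; have := leaves_gt0 r.
  by case: (leaves l) (leaves r) => // a [|b] // _ _; rewrite addSn addnS; apply/eqP.
apply/flatten_mapP/idP => [[i]|].
  rewrite mem_iota => /andP[i1 ik] /allpairsP[[l r] /= [hl hr ->]] /=.
  have i_k : (i < k)%N by lia.
  have ki : (k - i <= n)%N by lia.
  move: hl hr; rewrite !IH // => [/eqP -> /eqP ->|].
    by rewrite subnKC // ltnW.
  by rewrite -ltnS (leq_trans i_k).
case: T => [|l r] /=; first by rewrite eq_sym (negbTE k1).
move=> /eqP hk; have l0 := leaves_gt0 l; have r0 := leaves_gt0 r.
have lk : (leaves l < k)%N by rewrite -hk -{1}[leaves l]addn0 ltn_add2l.
have rk : (leaves r < k)%N by rewrite -hk -{1}[leaves r]add0n ltn_add2r.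
exists (leaves l).
  by rewrite mem_iota l0 add1n prednK // (leq_trans _ lk).
apply/allpairsP; exists (l, r); split => //=; rewrite IH //.
- by rewrite -ltnS (leq_trans lk).
- by rewrite -hk addKn.
- by rewrite -hk addKn -ltnS (leq_trans rk).
Qed.

Lemma mem_trees k T : (T \in trees k) = (leaves T == k).
Proof. exact: mem_trees_rec. Qed.

Lemma uniq_trees_rec n k : (k <= n)%N -> uniq (trees_rec n k).
Proof.
elim: n k => [|n IH] k kn //=; case: (k =P 1%N) => // /eqP k1.
have : {in iota 1 k.-1, forall i, (0 < i < k)%N}.
  by move=> i; rewrite mem_iota; lia.
have := iota_uniq 1 k.-1; elim: (iota 1 k.-1) => //= i s IHs /andP[is_ us] hs.
have /andP[i0 ik] : (0 < i < k)%N by apply: hs; rewrite inE eqxx.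
rewrite cat_uniq IHs //; last by move=> j js; apply: hs; rewrite inE js orbT.
have i_n : (i <= n)%N by rewrite -ltnS (leq_trans ik).
rewrite andbT; apply/andP; split.
  apply: allpairs_uniq.
  - exact: IH.
  - by apply: IH; lia.
  - by move=> [l r] [l' r'] _ _ [-> ->].
apply/hasPn => T /flatten_mapP[j js] /allpairsP[[l r] /= [hl hr ->]].
apply/negP => /allpairsP[[l' r'] /= [hl' _ [e _]]].
have /andP[j0 jk] : (0 < j < k)%N by apply: hs; rewrite inE js orbT.
move: hl' hl; rewrite -e !mem_trees_rec // => [/eqP -> /eqP ij|].
  by rewrite ij js in is_.
by rewrite -ltnS (leq_trans jk).
Qed.

Lemma uniq_trees k : uniq (trees k).
Proof. exact: uniq_trees_rec. Qed.

Section Transfer.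
Variables (F : fieldType) (C : dgcoalg F) (V : complex F) (r : hretract C V).

(* b(s^-1 c) = - sum (-1)^|c'| s^-1 c' (x) s^-1 c'' *)
Definition bmap (x : desusp C) : gtens (desusp C) (desusp C) :=
  - tensm (-1) (@sdown F C) (@sdown F C) (coprod C (sraise x)).

Definition Hmap (x : desusp C) : desusp C := - sdown (hr_K r (sraise x)).
Definition ihat (w : desusp V) : desusp C := sdown (hr_i r (sraise w)).
Definition phat (x : desusp C) : desusp V := sdown (hr_p r (sraise x)).

(* (f (x) g) o b, followed by concatenation of tensors; there is no Koszul sign
   for maps [f] and [g] of degree 0. *)
Definition vertex_op (f g : desusp C -> that (desusp V)) (x : desusp C) :
    that (desusp V) :=
  tlift (fun y z => tmul (f y) (g z)) (bmap x).

(* The operation of the subtree [T] together with the edge below it. It has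
   degree 0 since each internal edge, labelled by H, is composed with the
   vertex above it, labelled by b. *)
Fixpoint edge_op (T : pbtree) (x : desusp C) : that (desusp V) :=
  match T with
  | Leaf => tgen (phat x)
  | Node T1 T2 => vertex_op (edge_op T1) (edge_op T2) (Hmap x)
  end.

(* d_T; the tree with a single leaf does not occur in the sums below. *)
Definition tree_op (T : pbtree) (w : desusp V) : that (desusp V) :=
  match T with
  | Leaf => tgen (phat (ihat w))
  | Node T1 T2 => vertex_op (edge_op T1) (edge_op T2) (ihat w)
  end.

Definition transfer_comp (k : nat) (w : desusp V) : that (desusp V) :=
  match k with
  | 0%N => 0
  | 1%N => tgen (- sdown (cx_d V (sraise w)))
  | _ => \sum_(T <- trees k) tree_op T w
  end.

Definition transfer_gen (w : desusp V) : that (desusp V) :=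
  fun k => transfer_comp k w k.

Definition transferred_differential : that (desusp V) -> that (desusp V) :=
  thatder transfer_gen.

Lemma bmap_linear : linear bmap.
Proof.
move=> a x y; rewrite /bmap linearP.
rewrite (tensm_linear (-1) (@sdown F C) (@sdown F C)) opprD.
by rewrite scalerN.
Qed.

Lemma vertex_op_bilinear (f g : desusp C -> that (desusp V)) :
  linear f -> linear g -> bilinear_map (fun y z => tmul (f y) (g z)).
Proof.
move=> lf lg; split=> [z|y] a u v /=; first by rewrite lf (tmul_bilinear (desusp V)).1.
by rewrite lg (tmul_bilinear (desusp V)).2.
Qed.

Lemma vertex_op_linear f g : linear f -> linear g -> linear (vertex_op f g).
Proof.
move=> lf lg a x y; rewrite /vertex_op bmap_linear.
by rewrite (tlift_linear (vertex_op_bilinear lf lg)).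
Qed.

Lemma Hmap_linear : linear Hmap.
Proof. by move=> a x y; rewrite /Hmap !linearP. Qed.

Lemma ihat_linear : linear ihat.
Proof. exact: (linearP (hr_i r)). Qed.

Lemma phat_linear : linear phat.
Proof. exact: (linearP (hr_p r)). Qed.

Lemma edge_op_linear T : linear (edge_op T).
Proof.
elim: T => [|T1 h1 T2 h2] a x y /=; first by rewrite phat_linear tgen_linear.
by rewrite Hmap_linear vertex_op_linear.
Qed.

Lemma tree_op_linear T : linear (tree_op T).
Proof.
case: T => [|T1 T2] a x y /=; first by rewrite ihat_linear phat_linear tgen_linear.
by rewrite ihat_linear vertex_op_linear //; exact: edge_op_linear.
Qed.

Lemma bmap_degree : has_degree (-1) bmap.
Proof.
move=> p x hx; rewrite /bmap; apply: homogN.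
have : homog (p + 1) (coprod C (sraise x)).
  by rewrite -[p + 1]addr0; apply: coprod_degree; exact: sraise_degree.
move: (coprod C (sraise x)); apply: gtens_homog_ind => [|y z hy hz|q s v w e hv hw].
- by rewrite (lin0 (tensm_linear _ _ _)); exact: homog0.
- by rewrite (linD (tensm_linear _ _ _)); exact: homogD.
- rewrite (tensm_pure _ _ _ _ hv); apply: homogZ.
  have -> : p - 1 = (q - 1) + (s - 1) by lia.
  by apply: homog_tpure; exact: sdown_degree.
Qed.

Lemma vertex_op_degree (f g : desusp C -> that (desusp V)) p x :
  linear f -> linear g ->
  (forall q y, homog q y -> thomog q (f y)) ->
  (forall q y, homog q y -> thomog q (g y)) ->
  homog p x -> thomog (p - 1) (vertex_op f g x).
Proof.
move=> lf lg hf hg /bmap_degree; rewrite /vertex_op.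
have bl := vertex_op_bilinear lf lg.
move: (bmap x); apply: gtens_homog_ind => [|y z hy hz|q s v w e hv hw].
- by rewrite (lin0 (tlift_linear bl)) => n; exact: homog0.
- by rewrite (linD (tlift_linear bl)) => n; exact: homogD.
- by rewrite tlift_pure // e; apply: thomog_mul; [exact: hf | exact: hg].
Qed.

Lemma edge_op_degree T p x : homog p x -> thomog p (edge_op T x).
Proof.
elim: T p x => [|T1 h1 T2 h2] p x hx /=.
  apply: thomog_gen; have := hr_p_degree r (hx : homog (p + 1) (sraise x)).
  by rewrite addr0.
rewrite -[p](addrK 1); apply: vertex_op_degree => //; try exact: edge_op_linear.
by apply: homogN; exact: (hr_K_degree r (hx : homog (p + 1) (sraise x))).
Qed.

Lemma vertex_op_len (f g : desusp C -> that (desusp V)) j k x :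
  linear f -> linear g -> (forall y, tlen j (f y)) -> (forall y, tlen k (g y)) ->
  tlen (j + k) (vertex_op f g x).
Proof.
move=> lf lg hf hg; rewrite /vertex_op.
have bl := vertex_op_bilinear lf lg.
elim/tens_ind: (bmap x) => [|y z hy hz|v w] n nk.
- by rewrite (lin0 (tlift_linear bl)).
- rewrite (linD (tlift_linear bl)).
  exact: etrans (congr2 +%R (hy n nk) (hz n nk)) (addr0 _).
- by rewrite tlift_pure //; apply: tlen_mul nk.
Qed.

Lemma edge_op_len T x : tlen (leaves T) (edge_op T x).
Proof.
elim: T x => [|T1 h1 T2 h2] x; first exact: tlen_gen.
by apply: vertex_op_len => //; exact: edge_op_linear.
Qed.

Lemma tree_op_len T w : tlen (leaves T) (tree_op T w).
Proof.
case: T => [|T1 T2]; first exact: tlen_gen.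
by apply: vertex_op_len; try exact: edge_op_linear; exact: edge_op_len.
Qed.

Lemma transfer_gen_linear : linear transfer_gen.
Proof.
move=> a w w'; apply: that_ext => -[|[|k]]; rewrite that_linE.
- by rewrite -[RHS]/(a *: 0 + 0) scaler0 addr0.
- rewrite /transfer_gen /transfer_comp -that_linE -tgen_linear.
  apply: (congr1 (fun u : desusp V => tgen u 1%N)).
  by rewrite !linearP.
- rewrite /transfer_gen /transfer_comp !that_sumE scaler_sumr -big_split.
  by apply: eq_bigr => T _; rewrite tree_op_linear.
Qed.

Lemma transferred_differential_gen w :
  transferred_differential (tgen w) = transfer_gen w.
Proof.
by apply: thatder_gen => //; exact: transfer_gen_linear.
Qed.

End Transfer.

(* Main.v *)
Require Import Defs.
From HB Require Import structures.
From mathcomp Require Import all_boot all_order all_algebra.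
From mathcomp Require Import zify ring.
Set Implicit Arguments.
Unset Strict Implicit.
Unset Printing Implicit Defensive.
Import GRing.Theory.
Local Open Scope ring_scope.

(** Cocommutativity of the coproduct makes [b] antisymmetric for the graded
    twist on [s^-1 C], so that [b = (b - twist b) / 2].  A sum over all planar
    trees with [k] leaves is, splitting at the lowest vertex, a sum over
    [i + j = k] of [(E_i (x) E_j) b], where [E_i] is the sum over the trees with
    [i] leaves; the family [(i, j)] is symmetric, so it is half a sum of graded
    commutators of values of [E_i] and [E_j], and induction on [k] applies. *)

Lemma signz_addM2 (F : fieldType) (m n : int) :
  (-1 : F) ^ (m + n * 2) = (-1) ^ m.
Proof.
have N1 : (-1 : F) \is a GRing.unit by rewrite unitrN1.
have sq1 : (-1 : F) ^ (2 : int) = 1 by rewrite -[LHS]/((-1) ^+ 2) sqrrN expr1n.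
by rewrite exprzDr // [n * 2]mulrC -exprz_exp sq1 exp1rz mulr1.
Qed.

Section FreeLie.
Variables (F : fieldType) (W : grmod F).

Lemma free_lie_sum (I : Type) (s : seq I) (P : pred I) (f : I -> that W) :
  (forall i, P i -> free_lie (f i)) -> free_lie (\sum_(i <- s | P i) f i).
Proof. by move=> h; elim/big_ind: _ => //; [exact: Lie_zero | exact: Lie_add]. Qed.

Lemma thomog_sum p (I : Type) (s : seq I) (P : pred I) (f : I -> that W) :
  (forall i, P i -> thomog p (f i)) -> thomog p (\sum_(i <- s | P i) f i).
Proof. by move=> h n; rewrite that_sumE; apply: homog_sum => i Pi; exact: h. Qed.

Lemma tproj_tlen n (x y : that W) : tlen n x -> y n = x n -> tproj n y = x.
Proof.
move=> hx e; apply: that_ext => m; rewrite /tproj.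
by have [->|/hx ->] := eqVneq m n.
Qed.

Section Convolution.
Variables (U : grmod F) (E : nat -> U -> that W) (k : nat).

(** All splittings of [k] are summed before a tensor is inserted, so that the reflection
    [i <-> k - i] acts on the terms. *)
Definition conv (y z : U) : that W :=
  \sum_(1 <= i < k) tmul (E i y) (E (k - i) z).

Hypotheses (E_lin : forall i, linear (E i))
  (E_deg : forall i p x, homog p x -> thomog p (E i x))
  (E_lie : forall i x, (0 < i < k)%N -> free_lie (E i x)).

Lemma conv_bilinear : bilinear_map conv.
Proof.
split=> [z|y] a u v; rewrite /conv scaler_sumr -big_split; apply: eq_bigr => i _.
  by rewrite E_lin (tmul_bilinear W).1.
by rewrite E_lin (tmul_bilinear W).2.
Qed.

(** On [y *t z], reflecting the index in the twisted sum pairs [E i y] with [E (k - i) z] in both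
    orders. As each [E i] preserves degrees, the Koszul sign of the twist is that of the bracket. *)
Lemma conv_twist_lie (t : gtens U U) :
  free_lie (tlift conv t - tlift conv (twist t)).
Proof.
have lc := tlift_linear conv_bilinear.
have lt := tlift_linear (twist_bilinear U U).
elim/gtens_ind: t => [|x y hx hy|p q y z hy hz].
- by rewrite /twist (lin0 lt) (lin0 lc) subr0; exact: Lie_zero.
- rewrite /twist (linD lt) !(linD lc) opprD addrACA.
  exact: Lie_add.
- rewrite (twist_pure hy hz) (linZ lc) !tlift_pure; try exact: conv_bilinear.
  rewrite /conv [X in _ *: X]big_nat_rev /= scaler_sumr -sumrB big_nat.
  apply: free_lie_sum => i /andP[i0 ik].
  have -> : (1 + k - i.+1 = k - i)%N by lia.
  have -> : (k - (k - i) = i)%N by lia.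
  by apply: Lie_bracket; try exact: E_deg; apply: E_lie; lia.
Qed.

Lemma conv_antisym_lie (t : gtens U U) :
  2%:R != 0 :> F -> twist t = - t -> free_lie (tlift conv t).
Proof.
move=> two0 tw; have lc := tlift_linear conv_bilinear.
(* Antisymmetry turns the difference into twice [tlift conv t]. *)
have := Lie_scale 2%:R^-1 (conv_twist_lie t).
rewrite tw -[- t]scaleN1r (linZ lc) scaleN1r opprK -mulr2n -scaler_nat scalerA.
by rewrite mulVf // scale1r.
Qed.

End Convolution.
End FreeLie.

Lemma big_trees (M : nmodType) (f : pbtree -> M) k : (1 < k)%N ->
  \sum_(T <- trees k) f T =
  \sum_(1 <= i < k) \sum_(l <- trees i) \sum_(r <- trees (k - i)) f (Node l r).
Proof.
(* The recursion lists subtrees with fuel left over from the whole tree; surplus fuel affects the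
   list at most by a permutation. *)
have perm_fuel n i : (i <= n)%N -> perm_eq (trees_rec n i) (trees i).
  move=> ni; apply: uniq_perm; [exact: uniq_trees_rec | exact: uniq_trees |].
  by move=> T; rewrite mem_trees_rec // mem_trees.
case: k => [|[|k]] // _.
have -> : trees k.+2 = flatten [seq [seq Node l r | l <- trees_rec k.+1 i,
    r <- trees_rec k.+1 (k.+2 - i)] | i <- iota 1 k.+1] by [].
rewrite big_flatten big_map /index_iota subSS subn0 big_seq [RHS]big_seq.
apply: eq_bigr => i; rewrite mem_iota => hi.
rewrite big_allpairs_dep (perm_big _ (perm_fuel k.+1 i _)) /=; last by lia.
apply: eq_bigr => l _; apply: perm_big; apply: (perm_fuel k.+1); lia.
Qed.

(** In [(p - 1)(q - 1) = pq - p - q + 1], the Koszul signs of [sdown] account for the linear terms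
    modulo 2, and the constant 1 gives the minus sign. *)
Lemma twist_desusp (F : fieldType) (U V : grmod F) (t : gtens U V) :
  twist (tensm (-1) (@sdown F U) (@sdown F V) t) =
  - tensm (-1) (@sdown F V) (@sdown F U) (twist t).
Proof.
have lt := tlift_linear (twist_bilinear U V).
have lt' := tlift_linear (twist_bilinear (desusp U) (desusp V)).
have ls := tensm_linear (-1) (@sdown F U) (@sdown F V).
have ls' := tensm_linear (-1) (@sdown F V) (@sdown F U).
elim/gtens_ind: t => [|x y hx hy|p q u v hu hv].
- by rewrite (lin0 ls) /twist (lin0 lt) (lin0 lt') (lin0 ls') oppr0.
- rewrite (linD ls) /twist (linD lt) (linD lt') (linD ls').
  by rewrite -[LHS]/(twist _ + twist _) hx hy -opprD.
rewrite (tensm_pure _ _ _ _ hu) (twist_pure hu hv) (linZ ls').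
rewrite (tensm_pure _ _ _ _ hv) /twist (linZ lt').
rewrite -[tlift _ _]/(twist (sdown u *t sdown v)).
rewrite (twist_pure (sdown_degree hu) (sdown_degree hv)) !scalerA -scaleNr.
congr (_ *: _).
have N1 : (-1 : F) \is a GRing.unit by rewrite unitrN1.
rewrite -[RHS]mulN1r -[X in _ = X * _]expr1z -!exprzDr //.
(* The two exponents differ by the even number [- p * 2]. *)
by rewrite -[RHS](signz_addM2 _ _ (- p)); congr (_ ^ _); ring.
Qed.

Section Transfer.
Variables (F : fieldType) (C : dgcoalg F) (V : complex F) (r : hretract C V).

Definition edge_sum (k : nat) (x : desusp C) : that (desusp V) :=
  \sum_(T <- trees k) edge_op r T x.

Lemma edge_sum_linear k : linear (edge_sum k).
Proof.
move=> a x y; rewrite /edge_sum scaler_sumr -big_split.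
by apply: eq_bigr => T _; rewrite edge_op_linear.
Qed.

Lemma edge_sum_degree k p x : homog p x -> thomog p (edge_sum k x).
Proof. by move=> hx; apply: thomog_sum => T _; exact: edge_op_degree. Qed.

Lemma vertex_sum k x : (1 < k)%N ->
  \sum_(1 <= i < k) \sum_(T1 <- trees i) \sum_(T2 <- trees (k - i))
     vertex_op (edge_op r T1) (edge_op r T2) x =
  tlift (conv edge_sum k) (bmap x).
Proof.
(* Unfolding [tlift] gives finite sums over one and the same representative of [bmap x], which can
   be exchanged with the sums over trees. *)
move=> k1; rewrite /vertex_op /tlift /conv [RHS]exchange_big.
apply: eq_bigr => i _ /=.
under eq_bigr do rewrite exchange_big /=.
rewrite exchange_big; apply: eq_bigr => c _ /=.
have tl z := (tmul_bilinear (desusp V)).1 z.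
have tr y := (tmul_bilinear (desusp V)).2 y.
rewrite /edge_sum (big_morph _ (linD (tl _)) (lin0 (tl _))).
by apply: eq_bigr => T _; rewrite (big_morph _ (linD (tr _)) (lin0 (tr _))).
Qed.

Hypotheses (two0 : 2%:R != 0 :> F) (cocomC : cocommutative C).

(** Cocommutativity enters here: the twist fixes the coproduct, and desuspension adds a sign. *)
Lemma twist_bmap x : twist (bmap x) = - bmap x :> gtens (desusp C) (desusp C).
Proof.
have lt := tlift_linear (twist_bilinear (desusp C) (desusp C)).
rewrite /bmap -[X in twist X]scaleN1r /twist (linZ lt) scaleN1r -/(twist _).
by rewrite twist_desusp cocomC.
Qed.

Lemma edge_sum_lie k x : free_lie (edge_sum k x).
Proof.
elim/ltn_ind: k x => k IH x; rewrite /edge_sum.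
case: (ltnP 1 k) => [k1|]; last first.
  (* No tree has zero leaves, and [Leaf] alone has one. *)
  case: k {IH} => [|[|]] // _; first by rewrite big_nil; exact: Lie_zero.
  by rewrite big_seq1; exact: Lie_gen.
rewrite big_trees // vertex_sum //.
apply: conv_antisym_lie => //; [exact: edge_sum_linear | exact: edge_sum_degree | | exact: twist_bmap].
by move=> i y /andP[_ ik]; exact: IH.
Qed.

(** The argument of [edge_sum_lie] once more, with [ihat w] at the root instead of [Hmap x]. *)
Lemma transfer_comp_lie k w : free_lie (transfer_comp r k w).
Proof.
case: k => [|[|k]]; [exact: Lie_zero | exact: Lie_gen |].
rewrite /transfer_comp big_trees // vertex_sum //.
apply: conv_antisym_lie => //; [exact: edge_sum_linear | exact: edge_sum_degree | | exact: twist_bmap].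
by move=> i y _; exact: edge_sum_lie.
Qed.

Lemma transfer_comp_len k w : tlen k (transfer_comp r k w).
Proof.
case: k => [|[|k]]; [by [] | exact: tlen_gen |] => n nk.
rewrite /transfer_comp that_sumE big_seq big1 // => T.
by rewrite mem_trees => /eqP hT; apply: tree_op_len; rewrite hT.
Qed.

End Transfer.

Theorem theorem2p2 (F : fieldType) (charF0 : [pchar F] =i pred0)
    (C : dgcoalg F) (V : complex F) (r : hretract C V)
    (cocomC : cocommutative C) (v : V) :
  complete_free_lie (transferred_differential r (tgen (sdown v))).
Proof.
have two0 : 2%:R != 0 :> F.
  by apply/negP => two0; have := charF0 2%N; rewrite !inE two0.
rewrite transferred_differential_gen; split=> // n.
(* Projecting to length [n] recovers all of [transfer_comp r n], which lives in that length only. *)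
rewrite (tproj_tlen (transfer_comp_len r (k := n) (sdown v))) //.
exact: transfer_comp_lie.
Qed.
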